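(* Assume that the binary relation $\preccurlyeq$ on $\mathcal{S}$ is transitive. Then, if $x\succcurlyeq y$, we have $\hat\tau_x\ge\hat\tau_y$.
   Context: $\mathcal{S}$ is a set with a binary relation $\preccurlyeq$ ($x\succcurlyeq y$ means $y\preccurlyeq x$). $X_1,\dots,X_n$ is a sample of points of $\mathcal{S}$. $\mathcal{C}(x)=\{z\in\mathcal{S}:z\succcurlyeq x\text{ or }z\preccurlyeq x\}$. $\mathbb{P}_n(A)=\frac1n\sum_{i=1}^n1\{X_i\in A\}$; $\mathbb{P}_n(A\mid B)=\mathbb{P}_n(A\cap B)/\mathbb{P}_n(B)$ if $\mathbb{P}_n(B)>0$ and zero otherwise. The estimated partial quantile index is $\hat\tau_x=\mathbb{P}_n(X_i\preccurlyeq x\mid\mathcal{C}(x))$, $x\in\mathcal{S}$. *)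

(* Defs.v *)
From Corelib Require Export RelationClasses.
From mathcomp Require Export all_boot all_order all_algebra.
From mathcomp Require Export boolp classical_sets reals numfun.

Set Implicit Arguments.
Unset Strict Implicit.
Unset Printing Implicit Defensive.

Import Order.TTheory GRing.Theory Num.Theory.
Local Open Scope classical_set_scope.
Local Open Scope ring_scope.

Section PartialQuantileIndex.

Variables (R : realType) (S : Type) (n : nat).
(* [prec x y] reads x ≼ y; no property of ≼ is assumed in the definitions.
   X_1, ..., X_n is indexed by 'I_n, i.e. from 0. *)
Variables (prec : S -> S -> Prop) (X : 'I_n -> S).

Definition comparable_set (x : S) : set S := [set z | prec x z \/ prec z x].

Definition emp_prob (A : set S) : R := n%:R^-1 * \sum_(i < n) \1_A (X i).

Definition emp_cond_prob (A B : set S) : R :=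
  if 0 < emp_prob B then emp_prob (A `&` B) / emp_prob B else 0.

Definition tau_hat (x : S) : R :=
  emp_cond_prob [set z | prec z x] (comparable_set x).

End PartialQuantileIndex.

Arguments emp_prob R {S n} X A.
Arguments emp_cond_prob R {S n} X A B.
Arguments tau_hat R {S n} prec X x.

(* Main.v *)
Require Import Defs.
From mathcomp Require Import lra.
Import Order.TTheory GRing.Theory Num.Theory.
Local Open Scope ring_scope.

(** Write D_x for the elements below x and U_x for those above x. Then
    tau_hat x = d / (d + e) with d = P_n(D_x) and e = P_n(U_x \ D_x). If y
    precedes x, transitivity gives D_y `<=` D_x and U_x \ D_x `<=` U_y \ D_y,
    and d / (d + e) is nondecreasing in d and nonincreasing in e. Removing D_x
    from U_x matters because the relation need not be antisymmetric. *)

Section EmpiricalProbability.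
Local Open Scope classical_set_scope.

Variables (R : realType) (S : Type) (n : nat) (X : 'I_n -> S).
Implicit Types A B : set S.

Lemma emp_prob_ge0 A : 0 <= emp_prob R X A.
Proof. by rewrite /emp_prob mulr_ge0 ?invr_ge0 ?ler0n// sumr_ge0. Qed.

Lemma le_emp_prob A B : A `<=` B -> emp_prob R X A <= emp_prob R X B.
Proof.
move=> AB; rewrite /emp_prob ler_wpM2l ?invr_ge0 ?ler0n// ler_sum// => i _.
rewrite !indicE ler_nat; case: (boolP (X i \in A)) => // /set_mem/AB XB.
by rewrite mem_set.
Qed.

Lemma emp_probU A B :
  emp_prob R X (A `|` B) = emp_prob R X A + emp_prob R X (B `\` A).
Proof.
rewrite /emp_prob -mulrDr -big_split/=; congr (_ * _); apply: eq_bigr => i _.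
rewrite !indicE in_setU in_setD -natrD.
by case: (X i \in A); case: (X i \in B).
Qed.

(* Division by 0 gives 0, which agrees with the convention P_n(A | B) = 0 when
   P_n(B) = 0. *)
Lemma emp_cond_probE A B :
  emp_cond_prob R X A B = emp_prob R X (A `&` B) / emp_prob R X B.
Proof.
rewrite /emp_cond_prob lt0r emp_prob_ge0 andbT.
by case: eqP => //= ->; rewrite invr0 mulr0.
Qed.

End EmpiricalProbability.

(** Cross-multiplying and cancelling [a * a'] leaves [a * b' <= a' * b]. *)
Lemma ler_proportion (R : realFieldType) (a b a' b' : R) :
  0 <= a -> 0 <= b' -> a <= a' -> b' <= b -> a / (a + b) <= a' / (a' + b').
Proof.
move=> a0 b'0 aa' b'b.
(* Denominators can vanish only when [a = 0], where the left side is 0; [a > 0] makes both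
   positive. *)
have [->|aN0] := eqVneq a 0; first by rewrite mul0r divr_ge0 ?addr_ge0//; lra.
have a_gt0 : 0 < a by rewrite lt0r aN0.
rewrite ler_pdivrMr; last by lra.
rewrite mulrAC ler_pdivlMr; last by lra.
by nra.
Qed.

Lemma tau_hatE (R : realType) (S : Type) (prec : S -> S -> Prop) (n : nat)
    (X : 'I_n -> S) (x : S) (D := [set z | prec z x]%classic)
    (U := [set z | prec x z]%classic) :
  tau_hat R prec X x =
  emp_prob R X D / (emp_prob R X D + emp_prob R X (U `\` D)%classic).
Proof.
have CE : comparable_set prec x = (U `|` D)%classic by [].
(* Absorption turns the numerator's set into [D]; the swap makes [emp_probU] split off [D] first. *)
by rewrite /tau_hat emp_cond_probE CE classical_sets.setKU classical_sets.setUC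
  emp_probU.
Qed.

Theorem theorem6 (R : realType) (S : Type) (prec : S -> S -> Prop)
    (prec_trans : Transitive prec)
    (n : nat) (n_gt0 : (0 < n)%N) (X : 'I_n -> S) (x y : S) :
  prec y x -> tau_hat R prec X x >= tau_hat R prec X y.
Proof.
move=> yx; rewrite !tau_hatE; apply: ler_proportion.
- exact: emp_prob_ge0.
- exact: emp_prob_ge0.
- by apply: le_emp_prob => z /= zy; apply: prec_trans yx.
- apply: le_emp_prob => z /= [xz Nzx]; split; first exact: prec_trans xz.
  (* A [z] below [y] would be below [x], contradicting [Nzx]. *)
  by move=> zy; apply/Nzx/(prec_trans _ y).
Qed.
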